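(* Let $\mathcal X=\{x\in\mathbb R^d: Ax\le b\}$ be a nonempty bounded polytope and let $\mathcal C\subseteq\mathbb R^d$ be a convex set. Let $x_0\in\mathcal X^\star(\mathcal C)$ and let $U\in\mathbb R^{d\times r}$ have linearly independent columns with $\operatorname{range}(U)\supseteq\operatorname{dir}(\mathcal X^\star(\mathcal C))$. Then for every $c\in\mathcal C$, $$\mathcal X^\star(c)=T_{U,x_0}\bigl(F_{U,x_0}(c)\bigr),$$ and moreover $$\min_{x\in\mathcal X}c^\top x=c^\top x_0+\min_{z\in\mathcal Z_{U,x_0}}(U^\top c)^\top z .$$
   Context: For $c\in\mathbb R^d$, $\mathcal X^\star(c):=\operatorname*{arg\,min}_{x\in\mathcal X}c^\top x$ (the set of all minimizers), and $\mathcal X^\star(\mathcal C):=\bigcup_{c\in\mathcal C}\mathcal X^\star(c)$. For a set $S\subseteq\mathbb R^d$, $\operatorname{dir}(S):=\operatorname{span}\{x-x':x,x'\in S\}$. For $x_0\in\mathcal X$ and $U\in\mathbb R^{d\times r}$ with linearly independent columns: $T_{U,x_0}(z):=x_0+Uz$ for $z\in\mathbb R^r$; $\mathcal Z_{U,x_0}:=\{z\in\mathbb R^r: T_{U,x_0}(z)\in\mathcal X\}$; $F_{U,x_0}(c):=\operatorname*{arg\,min}_{z\in\mathcal Z_{U,x_0}}(U^\top c)^\top z$ (the set of all minimizers). *)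

(* Defs.v *)
From HB Require Import structures.
From mathcomp Require Import all_boot all_order all_algebra.
From mathcomp Require Import all_classical all_reals all_analysis.
Set Implicit Arguments.
Unset Strict Implicit.
Unset Printing Implicit Defensive.
Import Order.TTheory GRing.Theory Num.Theory.
Import numFieldNormedType.Exports.
Local Open Scope classical_set_scope.
Local Open Scope ring_scope.

Definition dot (R : realType) (n : nat) (c x : 'cV[R]_n) : R :=
  (c^T *m x) ord0 ord0.

Definition polyhedron (R : realType) (m d : nat)
    (A : 'M[R]_(m, d)) (b : 'cV[R]_m) : set 'cV[R]_d :=
  [set x | forall i, (A *m x) i ord0 <= b i ord0].

Definition argmin (R : realType) (T : Type) (f : T -> R) (S : set T) : set T :=
  [set x | S x /\ forall y, S y -> f x <= f y].

(* [is_min S v] asserts both that the minimum of [S] exists and that it is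
   equal to [v]; such a [v] is unique. *)
Definition is_min (R : realType) (S : set R) (v : R) : Prop :=
  S v /\ lbound S v.

Definition Xstar (R : realType) (d : nat) (X : set 'cV[R]_d) (c : 'cV[R]_d)
    : set 'cV[R]_d :=
  argmin (dot c) X.

Definition Xstars (R : realType) (d : nat) (X C : set 'cV[R]_d)
    : set 'cV[R]_d :=
  \bigcup_(c in C) Xstar X c.

(* Span of an arbitrary set of vectors: all finite linear combinations, with
   [n = 0] giving the zero vector. *)
Definition set_span (R : realType) (V : lmodType R) (S : set V) : set V :=
  [set v | exists (n : nat) (a : 'I_n -> R) (s : 'I_n -> V),
      (forall i, S (s i)) /\ v = \sum_(i < n) a i *: s i].

Definition dir (R : realType) (d : nat) (S : set 'cV[R]_d) : set 'cV[R]_d :=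
  set_span [set v | exists x x', [/\ S x, S x' & v = x - x']].

Definition lin_indep_cols (R : realType) (d r : nat) (U : 'M[R]_(d, r))
    : bool :=
  free [tuple col j U | j < r].

Definition mx_range (R : realType) (d r : nat) (U : 'M[R]_(d, r))
    : set 'cV[R]_d :=
  range (fun z : 'cV[R]_r => U *m z).

Definition Tmap (R : realType) (d r : nat) (U : 'M[R]_(d, r)) (x0 : 'cV[R]_d)
    (z : 'cV[R]_r) : 'cV[R]_d :=
  x0 + U *m z.

Definition Zset (R : realType) (d r : nat) (X : set 'cV[R]_d)
    (U : 'M[R]_(d, r)) (x0 : 'cV[R]_d) : set 'cV[R]_r :=
  [set z | X (Tmap U x0 z)].

Definition Fsol (R : realType) (d r : nat) (X : set 'cV[R]_d)
    (U : 'M[R]_(d, r)) (x0 c : 'cV[R]_d) : set 'cV[R]_r :=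
  argmin (dot (U^T *m c)) (Zset X U x0).

(* Main.v *)
Require Import Defs.
From HB Require Import structures.
From mathcomp Require Import all_boot all_order all_algebra.
From mathcomp Require Import all_classical all_reals all_analysis.
Import Order.TTheory GRing.Theory Num.Theory.
Import numFieldNormedType.Exports.
Local Open Scope classical_set_scope.
Local Open Scope ring_scope.

(** A linear objective attains its minimum over the compact set [X]
    ([Xstar_nonempty]), so every cost [c] in [C] has a minimizer. Such a
    minimizer and [x0] both lie in [Xstars X C], hence their difference lies
    in [dir (Xstars X C)] and so in the range of [U] ([Xstars_sub_range]): the
    slice [x0 + range U] contains every minimizer of every cost in [C]. On
    that slice the objective is the reduced one shifted by the constant [dot c
    x0] ([dot_Tmap]). Minimizing over the slice is then the same as minimizing
    over [X], because a point that is optimal in the slice is at least as good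
    as some global minimizer ([argmin_slice], which is pure order theory). *)

Lemma mx_norm_trmx (R : realType) (p q : nat) (M : 'M[R]_(p, q)) :
  `|M^T| = `|M|.
Proof.
rewrite /Num.norm /= !mx_normrE.
rewrite (reindex (fun ij : 'I_p * 'I_q => (ij.2, ij.1))) /=; last first.
  by exists (fun ij => (ij.2, ij.1)) => -[].
by apply: eq_bigr => ij _; rewrite mxE.
Qed.

Lemma continuous_mulmx_tr (R : realType) (p q : nat) (M : 'M[R]_(p, q)) i :
  continuous (fun u : 'rV[R]_q => (M *m u^T) i ord0).
Proof.
have -> : (fun u : 'rV[R]_q => (M *m u^T) i ord0) =
          (fun u => \sum_(j < q) M i j * u ord0 j).
  by apply/funext => u; rewrite mxE; apply: eq_bigr => j _; rewrite mxE.
move=> u; apply: (cvg_big (@add_continuous R) (nbhs_filter u)) => j _.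
by apply: cvgM; [exact: cvg_cst | exact: coord_continuous].
Qed.

(** Transposition preserves the norm, so it carries the polyhedron to a closed
    bounded set of row vectors; that set is compact by [bounded_closed_compact]
    and the objective, still continuous, attains its minimum there. *)
Lemma Xstar_nonempty (R : realType) (m d : nat) (A : 'M[R]_(m, d))
    (b : 'cV[R]_m) (c : 'cV[R]_d) :
  polyhedron A b !=set0 -> bounded_set (polyhedron A b) ->
  Xstar (polyhedron A b) c !=set0.
Proof.
move=> [x Xx] Xbnd.
pose Y : set 'rV[R]_d := [set u | polyhedron A b u^T].
have Y0 : Y !=set0 by exists x^T; rewrite /Y /= trmxK.
have Ybnd : bounded_set Y.
  have [M [Mreal XM]] := Xbnd; exists M; split => // N /XM XN u /XN /=.
  by rewrite mx_norm_trmx.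
have Ycl : closed Y.
  have -> : Y = \bigcap_(i in [set: 'I_m])
      (fun u : 'rV[R]_d => (A *m u^T) i ord0) @^-1` [set y | y <= b i ord0].
    by apply/seteqP; split => u Yu i; [move=> _; exact: Yu | exact: Yu].
  apply: closed_bigI => i _; apply: closed_comp; last exact: closed_le.
  by move=> u _; exact: continuous_mulmx_tr.
have cdot : {within Y, continuous (fun u : 'rV[R]_d => dot c u^T)}.
  by apply: continuous_subspaceT; exact: continuous_mulmx_tr.
have [u uY umin] := EVT_min_rV Y0 (bounded_closed_compact Ybnd Ycl) cdot.
exists u^T; split; first exact: (set_mem uY).
move=> y Xy; have := umin y^T; rewrite trmxK; apply.
by apply/mem_set; rewrite /Y /= trmxK.
Qed.

Lemma dot_Tmap (R : realType) (d r : nat) (U : 'M[R]_(d, r))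
    (x0 c : 'cV[R]_d) (z : 'cV[R]_r) :
  dot c (Tmap U x0 z) = dot c x0 + dot (U^T *m c) z.
Proof. by rewrite /dot /Tmap mulmxDr mxE trmx_mul trmxK mulmxA. Qed.

Lemma Xstars_sub_range (R : realType) (d r : nat) (X C : set 'cV[R]_d)
    (U : 'M[R]_(d, r)) (x0 : 'cV[R]_d) :
  Xstars X C x0 -> dir (Xstars X C) `<=` mx_range U ->
  Xstars X C `<=` range (Tmap U x0).
Proof.
move=> Sx0 dirU x Sx.
have /dirU[z _ Uz] : dir (Xstars X C) (x - x0).
  exists 1%N, (fun=> 1), (fun=> x - x0); split; first by move=> _; exists x, x0.
  by rewrite big_ord1 scale1r.
by exists z => //; rewrite /Tmap Uz addrC subrK.
Qed.

(** Some global minimizer lies in the slice [range T], so the minimum over the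
    slice equals the global one; the constant [k] does not affect which
    parameters [z] are optimal. *)
Lemma argmin_slice (R : realType) (V W : Type) (f : V -> R) (X : set V)
    (T : W -> V) (g : W -> R) (k : R) :
  (forall z, f (T z) = k + g z) ->
  argmin f X !=set0 -> argmin f X `<=` range T ->
  argmin f X = T @` argmin g (T @^-1` X).
Proof.
move=> fT [x fx] sXT; have [w _ wx] := sXT x fx.
move: fx; rewrite -wx => -[XTw minw].
apply/seteqP; split => [y fy | _ [z [XTz minz] <-]].
  have [z _ zy] := sXT y fy; exists z => //.
  move: fy; rewrite -zy => -[XTz minz]; split => // v XTv.
  by have := minz _ XTv; rewrite !fT lerD2l.
split => // y Xy; apply: le_trans (minw y Xy).
by rewrite !fT lerD2l; exact: minz.
Qed.

Lemma argmin_is_min (R : realType) (V : Type) (f : V -> R) (X : set V) x :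
  argmin f X x -> is_min (f @` X) (f x).
Proof.
by move=> [Xx minx]; split; [exists x | move=> _ [y Xy <-]; exact: minx].
Qed.

Theorem mainTheorem2 (R : realType) (m d r : nat)
    (A : 'M[R]_(m, d)) (b : 'cV[R]_m) (C : set 'cV[R]_d)
    (x0 : 'cV[R]_d) (U : 'M[R]_(d, r))
    (X : set 'cV[R]_d) (hX : X = polyhedron A b)
    (X_nonempty : X !=set0) (X_bounded : bounded_set X)
    (C_convex : convex_set C)
    (hx0 : Xstars X C x0)
    (U_indep : lin_indep_cols U)
    (U_range : dir (Xstars X C) `<=` mx_range U) :
  forall c : 'cV[R]_d, C c ->
    Xstar X c = Tmap U x0 @` Fsol X U x0 c /\
    exists vX vZ : R,
      [/\ is_min (dot c @` X) vX,
          is_min (dot (U^T *m c) @` Zset X U x0) vZ &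
          vX = dot c x0 + vZ].
Proof.
move=> c Cc.
have X0 : Xstar X c !=set0.
  by rewrite hX; apply: Xstar_nonempty; rewrite -hX.
have sub : Xstar X c `<=` range (Tmap U x0).
  move=> x cx; apply: (Xstars_sub_range _ _ _ _ _ _ _ hx0 U_range).
  by exists c.
have fT := dot_Tmap R d r U x0 c.
have eqX : Xstar X c = Tmap U x0 @` Fsol X U x0 c.
  exact: (argmin_slice _ _ _ _ _ _ _ _ fT X0 sub).
split => //.
have [x cx] := X0.
have : Xstar X c x by [].
rewrite eqX => -[z Fz zx].
exists (dot c x), (dot (U^T *m c) z); split.
- exact: argmin_is_min.
- exact: argmin_is_min.
- by rewrite -zx fT.
Qed.
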